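(* Let $H\hookrightarrow G$ be an inclusion of finite graphs, where $G$ is connected and $|V^H|\ge 2$. Then $$h_{\mathrm{Kron}}^{H,G}\le h_0^{H,G}\qquad\text{and}\qquad \varphi_{\mathrm{Kron}}^{H,G}\le\varphi_0^{H,G}.$$
   Context: Let $G=(V^G,E^G)$ be a finite simple graph (unweighted) and $H=(V^H,E^H)$ a subgraph. View graphs as $1$-dimensional simplicial complexes with oriented edges; $C_0,C_1$ are real chains with the inner product for which simplices are orthonormal. Let $I$ be the incidence matrix of $G$ (matrix of $\partial_1^G:C_1^G\to C_0^G$), and $B$ and $D$ the submatrices of rows indexed by $V^H$ and by $V^G\setminus V^H$. Let $C_1^{G,H}=\{c\in C_1^G:\partial_1^Gc\in C_0^H\}=\ker D$, and let $P:C_1^G\to C_1^G$ be the orthogonal projection onto $C_1^{G,H}$. The persistent Laplacian is $\Delta_0^{H,G}=\partial_1^{G,H}(\partial_1^{G,H})^*=BPB^T$ on $C_0^H=\mathbb{R}^{V^H}$, where $\partial_1^{G,H}:C_1^{G,H}\to C_0^H$ is the restriction of $\partial_1^G$. For $A\subseteq V^H$, $\chi_A\in\mathbb{R}^{V^H}$ is its indicator vector. Define $$h_{\mathrm{Kron}}^{H,G}=\min_{\substack{V^H=H_1\sqcup H_2\\ H_1,H_2\ne\varnothing}}\frac{|V^H|\,\chi_{H_1}^T\Delta_0^{H,G}\chi_{H_1}}{|H_1||H_2|},\qquad \varphi_{\mathrm{Kron}}^{H,G}=\min_{\substack{\varnothing\ne H_1\subseteq V^H\\ |H_1|\le|V^H|/2}}\frac{\chi_{H_1}^T\Delta_0^{H,G}\chi_{H_1}}{|H_1|},$$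 $$h_0^{H,G}=\min_{\substack{V^H=H_1\sqcup H_2,\ V^G=G_1\sqcup G_2\\ \varnothing\ne H_i\subseteq G_i}}\frac{|V^H|\,|E(G_1,G_2)|}{|H_1||H_2|},\qquad \varphi_0^{H,G}=\min_{\substack{0\ne x\in\mathbb{R}^{V^H}\\ x\perp^1\ker(PB^T)}}\frac{\|PB^Tx\|_1}{\|x\|_1},$$ where $E(G_1,G_2)$ is the set of edges of $G$ between $G_1$ and $G_2$, and $x\perp^1Y$ means $\|x+y\|_1\ge\|x\|_1$ for all $y\in Y$. *)

(* Defs.v *)
From mathcomp Require Import all_boot all_order all_algebra.
From mathcomp Require Import classical_sets reals.

Set Implicit Arguments.
Unset Strict Implicit.
Unset Printing Implicit Defensive.

Import Order.TTheory GRing.Theory Num.Theory.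
Local Open Scope ring_scope.

Record sgraph := SGraph {
  vertex :> finType;
  adj : rel vertex;
  adj_sym : symmetric adj;
  adj_irr : irreflexive adj }.

Record subgraph (G : sgraph) := Subgraph {
  sub_vertex : {set G};
  sub_adj : rel G;
  sub_adj_sym : symmetric sub_adj;
  sub_adj_adj : forall x y, sub_adj x y -> adj x y;
  sub_adj_vertex : forall x y, sub_adj x y ->
    (x \in sub_vertex) && (y \in sub_vertex) }.

(* Each edge {x, y} is represented by exactly one of (x, y) and (y, x), so
   [arcs] is in bijection with the edge set and indexes the basis of C_1. *)
Record orientation (G : sgraph) := Orientation {
  arcs : {set G * G};
  arcs_adj : forall x y, (x, y) \in arcs -> adj x y;
  adj_arcs : forall x y, adj x y ->
    ((x, y) \in arcs) (+) ((y, x) \in arcs) }.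

Definition connected_graph (G : sgraph) := forall x y : G, connect (@adj G) x y.

Definition edges_between (G : sgraph) (A B : {set G}) : {set {set G}} :=
  [set [set x; y] | x in A, y in B & adj x y].

Definition bipartition (T : finType) (A A1 A2 : {set T}) :=
  A1 :|: A2 = A /\ [disjoint A1 & A2].

(* The value 0 is taken only if A has no least element. *)
Definition minimum (R : realType) (A : R -> Prop) : R :=
  xget 0 (fun m => A m /\ forall r, A r -> m <= r).

Definition norm1 (R : realType) (n : nat) (x : 'cV[R]_n) : R :=
  \sum_i `|x i 0|.

Definition orth1 (R : realType) (n : nat) (x : 'cV[R]_n)
    (Y : 'cV[R]_n -> Prop) :=
  forall y, Y y -> norm1 x <= norm1 (x + y).

(* [kermx U^T] is the orthogonal complement of the row space of U.  The
   library's projections act on row vectors, whence the transposition. *)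
Definition orth_proj (R : realType) (m : nat) (U : 'M[R]_m) : 'M[R]_m :=
  (proj_mx U (kermx U^T))^T.

Lemma capmx_kermx_tr (R : realType) (m : nat) (U : 'M[R]_m) :
  (U :&: kermx U^T)%MS = 0.
Proof.
apply/eqP; rewrite -submx0; apply/rV_subP => w.
rewrite sub_capmx => /andP[/submxP[z wE] /sub_kermxP wU].
have ww : w *m w^T = 0 by rewrite {2}wE trmx_mul mulmxA wU mul0mx.
suff -> : w = 0 by rewrite sub0mx.
apply/rowP => j; rewrite mxE; apply/eqP; rewrite -sqrf_eq0.
move/matrixP/(_ 0 0): ww; rewrite !mxE => /eqP.
rewrite psumr_eq0 => [/allP/(_ j)|i _]; last by rewrite mxE -expr2 sqr_ge0.
by rewrite mem_index_enum mxE expr2 => /(_ isT).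
Qed.

Lemma orth_proj_sub (R : realType) (m : nat) (U : 'M[R]_m) (c : 'cV[R]_m) :
  ((orth_proj U *m c)^T <= U)%MS.
Proof. by rewrite trmx_mul trmxK proj_mx_sub. Qed.

Lemma orth_proj_orth (R : realType) (m : nat) (U : 'M[R]_m) (c : 'cV[R]_m) :
  U *m (c - orth_proj U *m c) = 0.
Proof.
apply: trmx_inj; rewrite trmx0 trmx_mul; apply/sub_kermxP.
rewrite linearB /= trmx_mul trmxK; apply: proj_mx_compl_sub.
apply: submx_full; rewrite -[row_full _]/(_ == _).
have := mxrank_sum_cap U (kermx U^T).
rewrite capmx_kermx_tr mxrank0 addn0 mxrank_ker mxrank_tr => ->.
by rewrite subnKC // rank_leq_row.
Qed.

Section PersistentLaplacian.
Variables (R : realType) (G : sgraph) (o : orientation G) (H : subgraph G).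

Let VH := sub_vertex H.

(* The boundary of the oriented edge (x, y) is y - x. *)
Definition incidence : 'M[R]_(#|G|, #|arcs o|) :=
  \matrix_(i, j) ((enum_val i == (enum_val j).2)%:R
                  - (enum_val i == (enum_val j).1)%:R).

Definition rows_of (A : {set G}) : 'M[R]_(#|A|, #|arcs o|) :=
  rowsub (fun i : 'I_#|A| => enum_rank (enum_val i)) incidence.

Definition incB : 'M[R]_(#|VH|, #|arcs o|) := rows_of VH.
Definition incD : 'M[R]_(#|~: VH|, #|arcs o|) := rows_of (~: VH).

(* The row space of [kermx incD^T] consists of the transposes of the column
   vectors in ker D. *)
Definition projP : 'M[R]_#|arcs o| := orth_proj (kermx incD^T).

(* The adjoint of the restriction of B to ker D, by the two lemmas below. *)
Definition persistent_coboundary : 'M[R]_(#|arcs o|, #|VH|) :=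
  projP *m incB^T.

Lemma persistent_coboundary_ker (x : 'cV[R]_#|VH|) :
  incD *m (persistent_coboundary *m x) = 0.
Proof.
apply: trmx_inj; rewrite trmx0 trmx_mul; apply/sub_kermxP.
by rewrite -mulmxA; apply: orth_proj_sub.
Qed.

Lemma persistent_coboundary_adj (c : 'cV[R]_#|arcs o|) (x : 'cV[R]_#|VH|) :
  incD *m c = 0 -> (incB *m c)^T *m x = c^T *m (persistent_coboundary *m x).
Proof.
move=> /(congr1 trmx); rewrite trmx0 trmx_mul => /sub_kermxP/submxP[z cE].
apply/eqP; rewrite -subr_eq0 trmx_mul -!mulmxA -mulmxBr cE -mulmxA.
by rewrite orth_proj_orth mulmx0.
Qed.

Definition persistent_laplacian : 'M[R]_#|VH| :=
  incB *m persistent_coboundary.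

Definition chi (A : {set G}) : 'cV[R]_#|VH| :=
  \col_i (enum_val i \in A)%:R.

Definition energy (A : {set G}) : R :=
  ((chi A)^T *m persistent_laplacian *m chi A) 0 0.

Definition hKron : R := minimum (fun r => exists H1 H2 : {set G},
  [/\ bipartition VH H1 H2, H1 != finset.set0, H2 != finset.set0 &
      r = #|VH|%:R * energy H1 / (#|H1|%:R * #|H2|%:R)]).

Definition phiKron : R := minimum (fun r => exists H1 : {set G},
  [/\ H1 != finset.set0, H1 \subset VH, #|H1|%:R <= #|VH|%:R / 2 :> R &
      r = energy H1 / #|H1|%:R]).

Definition h0 : R := minimum (fun r => exists H1 H2 G1 G2 : {set G},
  [/\ bipartition VH H1 H2, bipartition [set: G] G1 G2,
      H1 != finset.set0 /\ H1 \subset G1, H2 != finset.set0 /\ H2 \subset G2 &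
      r = #|VH|%:R * #|edges_between G1 G2|%:R / (#|H1|%:R * #|H2|%:R)]).

Definition phi0 : R := minimum (fun r => exists x : 'cV[R]_#|VH|,
  [/\ x != 0, orth1 x (fun y => persistent_coboundary *m y = 0) &
      r = norm1 (persistent_coboundary *m x) / norm1 x]).

End PersistentLaplacian.

(* Main.v *)
(* Write the coboundary of f : V(G) -> R as [grad f] = I^T f, and let A be a set
   of vertices of G.  Since I^T 1_A and B^T chi_A have the same inner product
   with every chain in ker D, the vector P B^T chi_A is the projection of
   I^T 1_A, and hence energy(A) <= |I^T 1_A|^2 = |E(A, V(G) \ A)|.  With
   A = G_1 this is the first inequality.

   For the second, c - Pc lies in the row space of D, so P B^T x = I^T f for
   some extension f of x to V(G).  If x is l^1-orthogonal to the constants then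
   0 is a median of x, so every superlevel set of f^+ and of f^- meets V(H) in
   at most half of V(H).  Integrating |E(A, V(G) \ A)| >= energy(A) >=
   phi_Kron |A :&: V(H)| over these sets (coarea formula) gives
   |I^T f|_1 >= phi_Kron |x|_1.  The infimum defining phi_0 is attained, by
   compactness of the admissible part of the l^1 sphere. *)

Require Import Defs.
From mathcomp Require Import all_boot all_order all_algebra.
From mathcomp Require Import classical_sets reals.
From mathcomp Require Import boolp topology normedtype derive.
From mathcomp Require Import ring lra.
Import Order.TTheory GRing.Theory Num.Theory.
Import numFieldNormedType.Exports.
Local Open Scope ring_scope.

Set Implicit Arguments.
Unset Strict Implicit.
Unset Printing Implicit Defensive.

(** * Attainment of minima *)

(** A least element makes the choice in [minimum] genuine, ruling out its default value 0. *)
Lemma minimum_lb (R : realType) (A : R -> Prop) m :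
  A m -> (forall r, A r -> m <= r) ->
  A (minimum A) /\ forall r, A r -> minimum A <= r.
Proof.
move=> Am mA.
exact: (@xgetPex _ 0 (fun m => A m /\ forall r, A r -> m <= r)
          (ex_intro _ m (conj Am mA))).
Qed.

Lemma minimum_fin (R : realType) (T : finType) (f : T -> R) (A : R -> Prop) r0 :
  (forall r, A r -> exists t, r = f t) -> A r0 ->
  A (minimum A) /\ forall r, A r -> minimum A <= r.
Proof.
move=> Af Ar0; have [t0 ft0] := Af _ Ar0.
have At0 : `[< A (f t0) >] by apply/asboolP; rewrite -ft0.
case: (arg_minP (P := fun t => `[< A (f t) >]) f At0) => t /asboolP At tmin.
apply: minimum_lb At _ => r Ar; have [s rE] := Af _ Ar.
by rewrite rE; apply: tmin; apply/asboolP; rewrite -rE.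
Qed.

(** * The l^1 norm and l^1-orthogonality *)

Section Norm1.
Variable R : realType.

Lemma norm1_ge0 n (x : 'cV[R]_n) : 0 <= norm1 x.
Proof. exact: sumr_ge0. Qed.

Lemma norm1_eq0 n (x : 'cV[R]_n) : (norm1 x == 0) = (x == 0).
Proof.
apply/idP/eqP => [|->]; last first.
  by rewrite /norm1 big1 // => i _; rewrite mxE normr0.
rewrite psumr_eq0 // => /allP x0; apply/colP => i; rewrite mxE.
by have := x0 i; rewrite mem_index_enum normr_eq0 => /(_ isT)/eqP.
Qed.

Lemma norm1Z n (a : R) (x : 'cV[R]_n) : norm1 (a *: x) = `|a| * norm1 x.
Proof. by rewrite mulr_sumr; apply: eq_bigr => i _; rewrite mxE normrM. Qed.

Lemma orth1Z n (a : R) (x : 'cV[R]_n) (Y : 'cV[R]_n -> Prop) : a != 0 ->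
  (forall b y, Y y -> Y (b *: y)) -> orth1 x Y -> orth1 (a *: x) Y.
Proof.
move=> a0 YZ xY y /(YZ a^-1)/xY le_x.
by rewrite -[y](scalerKV a0) -scalerDr !norm1Z ler_wpM2l.
Qed.

Lemma continuous_norm1_affine m n (M : 'M[R]_(m, n)) (b : 'cV[R]_m) :
  continuous (fun u : 'rV[R]_n => norm1 (M *m u^T + b)).
Proof.
rewrite /norm1; apply: continuous_big => [|i _ u].
  exact: add_continuous.
apply: (@continuous_comp _ _ _ (fun u : 'rV[R]_n => (M *m u^T + b) i 0)
          (fun r : R => `|r|)); last exact: norm_continuous.
have -> : (fun u : 'rV[R]_n => (M *m u^T + b) i 0) =
    (fun u => \sum_j M i j * u 0 j + b i 0).
  apply/funext => v; rewrite !mxE; congr (_ + _).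
  by apply: eq_bigr => j _; rewrite mxE.
apply: (@continuousD _ _ _ (fun u : 'rV[R]_n => \sum_j M i j * u 0 j)
          (fun=> b i 0)); last exact: cst_continuous.
apply: continuous_big => [|j _ v]; first exact: add_continuous.
apply: (@continuousM _ _ (fun=> M i j) (fun v : 'rV[R]_n => v 0 j)).
  exact: cst_continuous.
exact: coord_continuous.
Qed.

(** Both the ratio and the constraint are invariant under nonzero scaling, so it suffices to
    minimise the continuous numerator over the admissible unit vectors, which form a compact set. *)
Lemma norm1_ratio_min m n (M : 'M[R]_(m, n)) (Y : 'cV[R]_n -> Prop) x0 :
    (forall b y, Y y -> Y (b *: y)) -> x0 != 0 -> orth1 x0 Y ->
  exists x, [/\ x != 0, orth1 x Y & forall y, y != 0 -> orth1 y Y ->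
    norm1 (M *m x) / norm1 x <= norm1 (M *m y) / norm1 y].
Proof.
move=> YZ x0_neq0 x0Y.
pose K := [set u : 'rV[R]_n | norm1 u^T = 1 /\ orth1 u^T Y]%classic.
have unitK y : y != 0 -> orth1 y Y -> ((norm1 y)^-1 *: y)^T \in K.
  move=> y0 yY; rewrite inE /K /= trmxK; split.
    by rewrite norm1Z ger0_norm ?invr_ge0 ?norm1_ge0 // mulVf // norm1_eq0.
  by apply: orth1Z; rewrite // invr_eq0 norm1_eq0.
have cont1 : continuous (fun u : 'rV[R]_n => norm1 u^T).
  rewrite (_ : (fun _ => _) = fun u => norm1 (1%:M *m u^T + 0)).
    exact: continuous_norm1_affine.
  by apply/funext => u; rewrite mul1mx addr0.
have cont2 b : continuous (fun u : 'rV[R]_n => norm1 (u^T + b)).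
  rewrite (_ : (fun _ => _) = fun u => norm1 (1%:M *m u^T + b)).
    exact: continuous_norm1_affine.
  by apply/funext => u; rewrite mul1mx.
(* Admissibility is an intersection, over [y] in [Y], of closed conditions on [u]. *)
have closedK : closed K.
  have -> : K = ([set u | norm1 u^T = 1%R] `&`
      \bigcap_(y in [set y | Y y])
        [set u : 'rV[R]_n | (0 <= norm1 (u^T + y)%R - norm1 u^T)%R])%classic.
    by apply/seteqP; split=> u /= [u1 uY]; split=> // y /uY /=; rewrite subr_ge0.
  apply: closedI.
    apply: (@preimage_closed _ _ (fun u : 'rV[R]_n => norm1 u^T)
              [set r : R | r = 1]%classic); last exact: closed_eq.
    by move=> u _; exact: cont1.
  apply: closed_bigI => y _.
  apply: (@preimage_closed _ _
            (fun u : 'rV[R]_n => norm1 (u^T + y) - norm1 u^T)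
            [set r : R | 0 <= r]%classic); last exact: closed_ge.
  move=> u _; apply: (@continuousB _ _ _ (fun u : 'rV[R]_n => norm1 (u^T + y))).
    exact: cont2.
  exact: cont1.
(* A vector of l^1 norm 1 has all its entries in [-1, 1], so [K] is a closed subset of a cube. *)
have compactK : compact K.
  have segK := @rV_compact R n (fun=> `[(-1 : R), 1]%classic)
                 (fun _ => @segment_compact R _ _).
  apply: (subclosed_compact closedK segK) => u /= [u1 _] i.
  rewrite in_itv /= -ler_norml -u1 /norm1 (bigD1 i) //= mxE lerDl.
  exact: sumr_ge0.
have contM :
    {within K, continuous (fun u : 'rV[R]_n => norm1 (M *m u^T))}%classic.
  apply: continuous_subspaceT.
  rewrite (_ : (fun _ => _) = fun u => norm1 (M *m u^T + 0)).
    exact: continuous_norm1_affine.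
  by apply/funext => u; rewrite addr0.
have [|u uK umin] := EVT_min_rV _ compactK contM.
  by exists ((norm1 x0)^-1 *: x0)^T; have := unitK _ x0_neq0 x0Y; rewrite inE.
move: uK; rewrite inE => -[u1 uY]; exists u^T; split=> //.
  by rewrite -norm1_eq0 u1 oner_eq0.
move=> y y0 yY; rewrite u1 divr1; apply: le_trans (umin _ (unitK _ y0 yY)) _.
rewrite trmxK -scalemxAr norm1Z ger0_norm ?invr_ge0 ?norm1_ge0 //.
by rewrite mulrC.
Qed.

(* Shifting x down to its least positive entry lowers the norm unless at most
   half of the entries are positive. *)
Lemma orth1_const_median n (x : 'cV[R]_n) (Y : 'cV[R]_n -> Prop) :
    (forall c, Y (const_mx c)) -> orth1 x Y ->
  (#|[pred i | 0 < x i ord0]|%:R <= n%:R / 2 :> R).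
Proof.
move=> Yc xY; set S := [pred i | _].
have [S0|[i0 Si0]] := set_0Vmem [set i in S].
  rewrite (_ : #|S| = 0%N) ?divr_ge0 //; apply/eq_card0 => i.
  by have /setP/(_ i) := S0; rewrite !inE.
have {}Si0 : i0 \in S by rewrite inE in Si0.
case: (arg_minP (fun i => x i 0) Si0) => k Sk kmin.
have xk0 : 0 < x k 0 by [].
have := xY _ (Yc (- x k 0)).
(* Entries in [S] are at least [x k 0] and shrink by that amount; the others are nonpositive and
   grow by it in absolute value. *)
have -> : norm1 (x + const_mx (- x k 0)) =
    norm1 x + \sum_i (if i \in S then - x k 0 else x k 0).
  rewrite -big_split /=; apply: eq_bigr => i _; rewrite !mxE.
  case: ifP => iS.
    have kl := kmin _ iS; have i0' : 0 < x i 0 by [].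
    rewrite (gtr0_norm i0') ger0_norm ?subr_ge0 //.
  have i0' : x i 0 <= 0 by move: iS; rewrite !inE ltNge => /negbFE.
  by rewrite (ler0_norm i0') ler0_norm; lra.
rewrite lerDl (bigID (mem S)) /=.
rewrite (eq_bigr (fun=> - x k 0)) => [|i ->] //.
rewrite (eq_bigr (fun=> x k 0) (P := fun i => i \notin S)) => [|i /negbTE ->] //.
(* The net change is [x k 0] times (n - 2|S|), and it is nonnegative. *)
rewrite !sumr_const -(mulr_natr (- x k 0)) -(mulr_natr (x k 0)).
have /(congr1 (fun k => k%:R : R)) := cardC S; rewrite card_ord natrD.
set a : R := #|S|%:R; set b : R := _%:R => <-.
rewrite mulNr addrC -mulrBr pmulr_rge0 // => ?; lra.
Qed.

End Norm1.

(** * Orthogonal projections *)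

(** The residual c - Pc is orthogonal to the row space of [U], which contains Pc. *)
Lemma orth_proj_dot (R : realType) m (U : 'M[R]_m) (c : 'cV[R]_m) :
  c^T *m (orth_proj U *m c) = (orth_proj U *m c)^T *m (orth_proj U *m c).
Proof.
have /submxP[z zE] := orth_proj_sub U c.
have := orth_proj_orth U c; set p := orth_proj U *m c in zE * => Uc0.
apply/eqP; rewrite -subr_eq0 -mulmxBl -linearB /=; apply/eqP/trmx_inj.
by rewrite trmx_mul trmxK trmx0 zE -mulmxA Uc0 mulmx0.
Qed.

(** The residual is orthogonal to ker D, and the orthogonal complement of ker D is the row space of
    D. *)
Lemma orth_proj_residual (R : realType) m n (D : 'M[R]_(m, n)) (c : 'cV[R]_n) :
  exists z, c - orth_proj (kermx D^T) *m c = D^T *m z.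
Proof.
set U := kermx D^T.
have UD : U *m D^T = 0 by apply/sub_kermxP.
have sub : (D <= kermx U^T)%MS.
  by apply/sub_kermxP; apply: trmx_inj; rewrite trmx_mul trmxK trmx0.
(* The inclusion [sub] is an equality because the ranks agree. *)
have /eqmxP eqD : (D == kermx U^T)%MS.
  rewrite -(geq_leqif (mxrank_leqif_eq sub)) mxrank_ker mxrank_tr mxrank_ker.
  by rewrite mxrank_tr subKn // rank_leq_col.
have: ((c - orth_proj U *m c)^T <= D)%MS.
  rewrite eqD; apply/sub_kermxP; apply: trmx_inj.
  by rewrite trmx_mul !trmxK trmx0 orth_proj_orth.
by case/submxP => z /(congr1 trmx); rewrite trmxK trmx_mul => ->; exists z^T.
Qed.

(** Projections do not increase length: the hypothesis turns |q - p|^2 >= 0 into |q|^2 - |p|^2 >=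
    0. *)
Lemma mulTmx_norm (R : realType) n (p q : 'cV[R]_n) :
  q^T *m p = p^T *m p -> (p^T *m p) 0 0 <= \sum_i (q i 0) ^+ 2.
Proof.
move=> pq.
have dotE (u v : 'cV[R]_n) : (u^T *m v) 0 0 = \sum_i u i 0 * v i 0.
  by rewrite mxE; apply: eq_bigr => i _; rewrite mxE.
have: 0 <= \sum_i (q i 0 - p i 0) ^+ 2.
  by apply: sumr_ge0 => i _; apply: sqr_ge0.
have -> : \sum_i (q i 0 - p i 0) ^+ 2 = \sum_i (q i 0) ^+ 2 +
    ((p^T *m p) 0 0 - ((q^T *m p) 0 0) *+ 2).
  rewrite !dotE -sumrMnl -sumrB -big_split /=; apply: eq_bigr => i _; ring.
by rewrite pq mulr2n; lra.
Qed.

(** * Gradients and the persistent coboundary *)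

Section Coboundary.
Variables (R : realType) (G : sgraph) (o : orientation G) (H : subgraph G).
Let VH := sub_vertex H.

Definition grad (f : G -> R) : 'cV[R]_#|arcs o| :=
  \col_j (f (enum_val j).2 - f (enum_val j).1).

Definition restr (A : {set G}) (f : G -> R) : 'cV[R]_#|A| :=
  \col_i f (enum_val i).

Lemma rows_of_restr (A : {set G}) (f : G -> R) j :
  ((rows_of R o A)^T *m restr A f) j 0 =
  f (enum_val j).2 *+ ((enum_val j).2 \in A)
  - f (enum_val j).1 *+ ((enum_val j).1 \in A).
Proof.
have pick (v : G) : \sum_(w in A) (w == v)%:R * f w = f v *+ (v \in A).
  have [vA|vA] := boolP (v \in A).
    rewrite (bigD1 v) //= eqxx mul1r big1 ?addr0 // => w /andP[_ /negbTE ->].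
    by rewrite mul0r.
  rewrite big1 // => w wA; case: eqP => [wv|_]; last by rewrite mul0r.
  by rewrite wv (negbTE vA) in wA.
rewrite -!pick -sumrB big_enum_val mxE; apply: eq_bigr => i _.
by rewrite !mxE enum_rankK mulrBl.
Qed.

Lemma grad_split f : grad f =
  (incB R o H)^T *m restr VH f + (incD R o H)^T *m restr (~: VH) f.
Proof.
apply/colP => j; rewrite [RHS]mxE !rows_of_restr mxE !inE.
by do 2![case: (_ \in VH)]; rewrite /= ?mulr0n ?mulr1n; ring.
Qed.

Lemma coboundary_dot (x : 'cV[R]_#|VH|) :
  ((incB R o H)^T *m x)^T *m (persistent_coboundary R o H *m x) =
  (persistent_coboundary R o H *m x)^T *m (persistent_coboundary R o H *m x).
Proof. by rewrite /persistent_coboundary -mulmxA orth_proj_dot. Qed.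

(** The two left factors differ by a vector in the range of D^T, which is orthogonal to ker D. *)
Lemma grad_dot_coboundary f (x : 'cV[R]_#|VH|) :
  (grad f)^T *m (persistent_coboundary R o H *m x) =
  ((incB R o H)^T *m restr VH f)^T *m (persistent_coboundary R o H *m x).
Proof.
rewrite grad_split linearD /= mulmxDl -[RHS]addr0; congr (_ + _).
by rewrite trmx_mul trmxK -mulmxA persistent_coboundary_ker mulmx0.
Qed.

Lemma extension (x : 'cV[R]_#|VH|) (z : 'cV[R]_#|~: VH|) :
  exists f, restr VH f = x /\ restr (~: VH) f = z.
Proof.
exists (fun v => \sum_(i | enum_val i == v) x i 0
               + \sum_(i | enum_val i == v) z i 0); split; apply/colP => i.
  rewrite mxE [X in _ + X]big_pred0 => [|k].
    rewrite addr0 (big_pred1 i) // => k; exact: (inj_eq enum_val_inj).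
  apply/negbTE/eqP => ki; have := enum_valP k.
  by rewrite ki inE enum_valP.
rewrite mxE big_pred0 => [|k].
  rewrite add0r (big_pred1 i) // => k; exact: (inj_eq enum_val_inj).
apply/negbTE/eqP => ki; have := enum_valP i.
by rewrite -ki inE enum_valP.
Qed.

Lemma coboundary_grad (x : 'cV[R]_#|VH|) :
  exists f, restr VH f = x /\ persistent_coboundary R o H *m x = grad f.
Proof.
have [z zE] := orth_proj_residual (incD R o H) ((incB R o H)^T *m x).
(* The values -z outside V(H) contribute exactly minus the residual D^T z of B^T x. *)
have [f [fx fz]] := extension x (- z); exists f; split=> //.
rewrite grad_split fx fz mulmxN -zE opprB addrC subrK.
by rewrite /persistent_coboundary mulmxA.
Qed.

(** The squared length of P B^T x equals its inner product with the gradient of a constant function,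
    which vanishes. *)
Lemma coboundary_const c :
  persistent_coboundary R o H *m (const_mx c : 'cV[R]_#|VH|) = 0.
Proof.
set x : 'cV[R]_#|VH| := const_mx c; set p := _ *m x.
have xE : x = restr VH (fun=> c) by apply/colP => i; rewrite !mxE.
have g0 : grad (fun=> c) = 0 by apply/colP => j; rewrite !mxE subrr.
have := grad_dot_coboundary (fun=> c) x; rewrite g0 trmx0 mul0mx -xE.
rewrite coboundary_dot -/p; clearbody p.
move/matrixP/(_ 0 0)/esym/eqP; rewrite !mxE psumr_eq0 => [/allP p0|i _].
  apply/colP => i; have := p0 i; rewrite mem_index_enum !mxE -expr2 sqrf_eq0.
  by move/(_ isT)/eqP.
by rewrite mxE -expr2 sqr_ge0.
Qed.

(** The coboundary is the gradient of an extension of [x]; if it vanishes, that extension is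
    constant along edges, hence on the connected graph. *)
Lemma coboundary_eq0 (Gconn : connected_graph G) (x : 'cV[R]_#|VH|) :
  persistent_coboundary R o H *m x = 0 -> exists c, x = const_mx c.
Proof.
have [f [fx ->]] := coboundary_grad x => /colP g0.
have fadj u v : adj u v -> f u = f v.
  have farc a : a \in arcs o -> f a.2 = f a.1.
    move=> ao; have := g0 (enum_rank_in ao a); rewrite !mxE enum_rankK_in //.
    by move/eqP; rewrite subr_eq0 => /eqP.
  move/(adj_arcs o); case: (boolP ((u, v) \in _)) => [/farc //|_ /farc //].
have fconst u v : f u = f v.
  have /connectP[p] := Gconn u v; elim: p u => [u _ -> //|w p IHp u /=].
  by case/andP => /fadj -> pw /(IHp _ pw).
have [v0 _|V0] := pickP (fun v : G => true).
  by exists (f v0); apply/colP => i; rewrite -fx !mxE.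
by exists 0; apply/colP => i; have := V0 (enum_val i).
Qed.

(** * Energies, cuts and the coarea argument *)

Definition ind (A : {set G}) : G -> R := fun v => (v \in A)%:R.

Lemma energyE (A : {set G}) :
  energy R o H A = ((persistent_coboundary R o H *m chi R H A)^T
                    *m (persistent_coboundary R o H *m chi R H A)) 0 0.
Proof.
rewrite /energy /persistent_laplacian -!mulmxA.
set x := chi R H A; rewrite (mulmxA _ _ x).
have -> : x^T *m (incB R o H *m ((persistent_coboundary R o H) *m x)) =
    ((incB R o H)^T *m x)^T *m (persistent_coboundary R o H *m x).
  by rewrite trmx_mul trmxK mulmxA.
by rewrite coboundary_dot.
Qed.

Lemma energy_le_cut (A : {set G}) : energy R o H A <= norm1 (grad (ind A)).
Proof.
rewrite energyE.
(* The entries are -1, 0 or 1, so the l^1 norm is the squared Euclidean norm. *)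
have -> : norm1 (grad (ind A)) = \sum_j (grad (ind A) j 0) ^+ 2.
  apply: eq_bigr => j _; rewrite mxE /ind.
  by do 2![case: (_ \in A)];
     rewrite ?subrr ?subr0 ?sub0r ?normrN ?normr0 ?normr1 ?sqrrN ?expr0n ?expr1n.
apply: mulTmx_norm; rewrite grad_dot_coboundary.
have -> : restr VH (ind A) = chi R H A by apply/colP => i; rewrite !mxE.
by rewrite coboundary_dot.
Qed.

Lemma energyI (A : {set G}) : energy R o H (A :&: VH) = energy R o H A.
Proof.
rewrite /energy; suff -> : chi R H (A :&: VH) = chi R H A by [].
by apply/colP => i; rewrite !mxE inE enum_valP andbT.
Qed.

(* An edge has only one of its two orientations in [arcs o], so
   (x, y) |-> {x, y} is injective there. *)
Lemma cut_le_edges_between (A B : {set G}) : bipartition [set: G] A B ->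
  norm1 (grad (ind A)) <= #|edges_between A B|%:R.
Proof.
case=> AB dAB.
have inB v : (v \in B) = (v \notin A).
  have := finset.in_setT v; rewrite -AB inE.
  have [vA _|_ //] := boolP (v \in A).
  by apply/negbTE; have := disjointFr dAB vA => ->.
pose S := [set a in arcs o | (a.1 \in A) != (a.2 \in A)].
have -> : norm1 (grad (ind A)) = #|S|%:R.
  transitivity (\sum_(a in arcs o) ((a.1 \in A) != (a.2 \in A))%:R : R).
    rewrite big_enum_val; apply: eq_bigr => j _; rewrite mxE /ind.
    by do 2![case: (_ \in A)];
      rewrite ?subrr ?subr0 ?sub0r ?normrN ?normr0 ?normr1.
  by rewrite -sum1_card natr_sum big_mkcond /= [RHS]big_mkcond /=;
    apply: eq_bigr => a _; rewrite inE;
    case: (_ \in arcs o) => //=; case: (_ != _).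
rewrite ler_nat -(card_in_imset (f := fun a : G * G => [set a.1; a.2])).
  apply/subset_leq_card/fintype.subsetP => _ /imsetP[[x y] + ->].
  rewrite !inE /= => /andP[/arcs_adj xy].
  have [xA|xA] := boolP (x \in A); have [yA|yA] := boolP (y \in A) => // _.
    by apply/imset2P; exists x y; rewrite ?inE ?inB ?yA.
  rewrite finset.setUC; apply/imset2P; exists y x; rewrite ?inE ?inB ?xA //=.
  by rewrite adj_sym.
move=> [x y] [x' y']; rewrite !inE /= => /andP[xy nxy] /andP[xy' _] /setP E.
have := E x; have := E y; rewrite !inE !eqxx orbT /=.
have nyx : x == y = false by apply/negbTE; apply: contra nxy => /eqP ->.
case: (eqVneq x x') => [<-|_] /=.
  by rewrite eq_sym nyx /= => /esym/eqP ->.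
move=> + /esym/eqP xy'E; rewrite -xy'E [y == x]eq_sym nyx orbF => /esym/eqP yx'.
(* In the remaining case (x', y') = (y, x), so both orientations of one edge would be arcs. *)
have := adj_arcs o (arcs_adj xy).
by rewrite xy yx' xy'E xy'.
Qed.

(* Induction on the support S of f: if m is the least positive value of f, then
   the variation of f is that of f - m 1_S plus m times the cut of S. *)
Lemma layer_cake (W : {set G}) (C : R) (f : G -> R) : (forall v, 0 <= f v) ->
    (forall A : {set G}, A \subset [set v | 0 < f v] ->
      C * #|A :&: W|%:R <= norm1 (grad (ind A))) ->
  C * \sum_(v in W) f v <= norm1 (grad f).
Proof.
have [n] := ubnP #|[set v | 0 < f v]|; elim: n f => // n IHn f ltn f0 cutC.
set S := [set v | 0 < f v] in ltn cutC *.
have [S0|[v0 v0S]] := set_0Vmem S.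
  rewrite big1 ?mulr0 ?norm1_ge0 // => v _.
  by have /setP/(_ v) := S0; rewrite !inE lt0r f0 andbT => /negbFE/eqP.
case: (arg_minP f v0S) => k kS kmin.
have {}kS : k \in S by [].
have fk : 0 < f k by move: kS; rewrite inE.
(* Removing the bottom layer kills [f] at [k], so the support becomes strictly smaller. *)
pose g v := f v - f k * ind S v.
have fS v : v \notin S -> f v = 0.
  by rewrite inE lt0r f0 andbT negbK => /eqP.
have g0 v : 0 <= g v.
  rewrite /g /ind; have [/kmin kv|_] := boolP (v \in S).
    by rewrite mulr1 subr_ge0.
  by rewrite mulr0 subr0.
have gS : [set v | 0 < g v] \subset S :\ k.
  apply/fintype.subsetP => v; rewrite !inE /g /ind.
  have [->|_ /=] := eqVneq v k; first by rewrite kS mulr1 subrr ltxx.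
  have [|/fS ->] := boolP (v \in S); first by rewrite inE.
  by rewrite mulr0 subr0.
have cutg : C * \sum_(v in W) g v <= norm1 (grad g).
  apply: IHn => // [|A AS].
    have := subset_leq_card gS; rewrite (cardsD1 k S) kS in ltn *.
    by move=> le; apply: leq_ltn_trans le _.
  apply: cutC; apply: fintype.subset_trans AS _.
  apply: fintype.subset_trans gS _.
  exact: finset.subD1set.
have -> : \sum_(v in W) f v = \sum_(v in W) g v + f k * #|S :&: W|%:R.
  have -> : #|S :&: W|%:R = \sum_(v in W) ind S v.
    rewrite -sum1_card natr_sum big_mkcond [RHS]big_mkcond /=.
    by apply: eq_bigr => v _; rewrite /ind inE; do 2![case: (v \in _)].
  rewrite mulr_sumr -big_split /=; apply: eq_bigr => v _; rewrite /g; ring.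
(* On an arc inside [S] the layer cancels; on an arc leaving [S] both functions vanish at the outer
   end, and [f] exceeds [g] by [f k] at the inner end. *)
have -> : norm1 (grad f) = norm1 (grad g) + f k * norm1 (grad (ind S)).
  rewrite /norm1 mulr_sumr -big_split /=; apply: eq_bigr => j _; rewrite !mxE.
  set a := (enum_val j).2; set b := (enum_val j).1.
  have := g0 a; have := g0 b; rewrite /g /ind.
  have [aS|aS] := boolP (a \in S); have [bS|bS] := boolP (b \in S);
    rewrite ?(fS _ aS) ?(fS _ bS) !(mulr0, mulr1, oppr0, subr0, sub0r, subrr,
      normr0, addr0, normrN, normr1) // => gb ga.
  - by rewrite opprB addrA subrK.
  - by rewrite !ger0_norm ?subrK ?f0.
  - by rewrite !ger0_norm ?subrK ?f0.
rewrite mulrDr lerD // mulrCA ler_wpM2l ?f0 //; exact: cutC.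
Qed.

(** The positive and negative parts of [f] are handled by [layer_cake] separately, and both sides of
    the inequality are additive over the two parts. *)
Lemma cheeger_grad (C : R) (f : G -> R) :
    (forall A : {set G}, (0 < #|A :&: VH|)%N ->
       #|A :&: VH|%:R <= #|VH|%:R / 2 :> R ->
       C * #|A :&: VH|%:R <= energy R o H A) ->
    orth1 (restr VH f) (fun y => persistent_coboundary R o H *m y = 0) ->
  C * norm1 (restr VH f) <= norm1 (grad f).
Proof.
move=> cutC fY.
(* Used with s = 1 and s = -1. Inside V(H), a set in the support of the positive part of [g] meets
   only positive entries, at most half of all by the median property. *)
have half (s : R) (g : G -> R) : restr VH g = s *: restr VH f -> s != 0 ->
    C * \sum_(v in VH) Num.max (g v) 0 <=
    norm1 (grad (fun v => Num.max (g v) 0)).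
  move=> gf s0; apply: layer_cake => [v|A As].
    by rewrite le_max lexx orbT.
  have [A0|A0] := posnP #|A :&: VH|; first by rewrite A0 mulr0 norm1_ge0.
  apply: le_trans (energy_le_cut A); apply: cutC A0 _.
  have gY : orth1 (restr VH g) (fun y => persistent_coboundary R o H *m y = 0).
    rewrite gf; apply: orth1Z => // b y y0.
    by rewrite -scalemxAr y0 scaler0.
  apply: le_trans (orth1_const_median coboundary_const gY).
  rewrite ler_nat -[X in (_ <= X)%N](card_image (f := @enum_val _ (mem VH)));
    last exact: enum_val_inj.
  apply/subset_leq_card/fintype.subsetP => v; rewrite inE => /andP[vA vH].
  apply/fintype.imageP; exists (enum_rank_in vH v); last
    by rewrite enum_rankK_in.
  have := fintype.subsetP As _ vA; rewrite !inE mxE enum_rankK_in //.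
  by rewrite lt_max ltxx orbF.
have le1 : C * \sum_(v in VH) Num.max (f v) 0 <=
    norm1 (grad (fun v => Num.max (f v) 0)).
  by apply: (half 1); rewrite ?scale1r ?oner_neq0.
have le2 : C * \sum_(v in VH) Num.max (- f v) 0 <=
    norm1 (grad (fun v => Num.max (- f v) 0)).
  apply: (half (-1)); rewrite ?oppr_eq0 ?oner_neq0 // scaleN1r.
  by apply/colP => i; rewrite !mxE.
have sgnP (c : R) : 0 <= c \/ c < 0 by case: (leP 0 c); [left | right].
have pos (c : R) : 0 <= c -> (Num.max c 0 = c) * (Num.max (- c) 0 = 0).
  by move=> c0; split; [rewrite max_l | rewrite max_r ?oppr_le0].
have neg (c : R) : c < 0 -> (Num.max c 0 = 0) * (Num.max (- c) 0 = - c).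
  by move=> c0; split; [rewrite max_r ?ltW | rewrite max_l ?oppr_ge0 ?ltW].
have normE : norm1 (restr VH f) =
    \sum_(v in VH) Num.max (f v) 0 + \sum_(v in VH) Num.max (- f v) 0.
  rewrite -big_split /= big_enum_val; apply: eq_bigr => i _; rewrite mxE.
  have [a0|a0] := sgnP (f (enum_val i)).
    by rewrite !(pos _ a0) addr0 ger0_norm.
  by rewrite !(neg _ a0) add0r ltr0_norm.
(* Along an arc the positive part of [f] and its negative part never vary in the same direction, so
   the absolute differences add up. *)
have gradE : norm1 (grad f) = norm1 (grad (fun v => Num.max (f v) 0)) +
    norm1 (grad (fun v => Num.max (- f v) 0)).
  rewrite /norm1 -big_split /=; apply: eq_bigr => j _; rewrite !mxE.
  set a := f _; set b := f _.
  have [a0|a0] := sgnP a; have [b0|b0] := sgnP b;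
    rewrite ?(pos _ a0) ?(pos _ b0) ?(neg _ a0) ?(neg _ b0).
  - by rewrite subrr normr0 addr0.
  - by rewrite subr0 sub0r opprK (ger0_norm a0) (ltr0_norm b0) ger0_norm; lra.
  - by rewrite sub0r subr0 !normrN (ger0_norm b0) (ltr0_norm a0) ler0_norm; lra.
  - by rewrite subrr normr0 add0r -opprD normrN.
by rewrite normE gradE mulrDr lerD.
Qed.

(** * The four constants as true minima *)

Lemma hKron_le (A B : {set G}) :
    bipartition VH A B -> A != finset.set0 -> B != finset.set0 ->
  hKron R o H <= #|VH|%:R * energy R o H A / (#|A|%:R * #|B|%:R).
Proof.
move=> AB A0 B0; set r := (X in _ <= X); rewrite /hKron.
set S := (X in minimum X).
have Sr : S r by exists A, B.
apply: (proj2 (minimum_fin (f := fun AB : {set G} * {set G} =>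
  #|VH|%:R * energy R o H AB.1 / (#|AB.1|%:R * #|AB.2|%:R)) _ Sr)) => //.
by move=> _ [A' [B' [_ _ _ ->]]]; exists (A', B').
Qed.

Lemma phiKron_le (A : {set G}) : A != finset.set0 -> A \subset VH ->
  #|A|%:R <= #|VH|%:R / 2 :> R -> phiKron R o H * #|A|%:R <= energy R o H A.
Proof.
move=> A0 AV A2; rewrite -ler_pdivlMr ?ltr0n ?card_gt0 //.
set r := (X in _ <= X); rewrite /phiKron; set S := (X in minimum X).
have Sr : S r by exists A.
apply: (proj2 (minimum_fin (f := fun A : {set G} =>
  energy R o H A / #|A|%:R) _ Sr)) => //.
by move=> _ [A' [_ _ _ ->]]; exists A'.
Qed.

Lemma h0_attained (cardH : (2 <= #|VH|)%N) : exists H1 H2 G1 G2 : {set G},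
  [/\ bipartition VH H1 H2, bipartition [set: G] G1 G2,
      H1 != finset.set0 /\ H1 \subset G1, H2 != finset.set0 /\ H2 \subset G2 &
      h0 R H = #|VH|%:R * #|edges_between G1 G2|%:R / (#|H1|%:R * #|H2|%:R)].
Proof.
rewrite /h0; set S := (X in minimum X); change (S (minimum S)).
have /card_gt1P[a [b [aV bV ab]]] := cardH.
(* Splitting off the single vertex [a], in H and in G, is admissible; [b] keeps the other side
   nonempty. *)
have aC : bipartition VH [set a] (VH :\ a).
  split; first exact: finset.setD1K.
  by rewrite disjoints1 !inE eqxx.
have aC' : bipartition [set: G] [set a] [set~ a].
  split; first by apply/setP => v; rewrite !inE; case: eqP.
  by rewrite disjoints1 !inE eqxx.
apply: (proj1 (minimum_fin
  (f := fun K : {set G} * {set G} * ({set G} * {set G}) =>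
  #|VH|%:R * #|edges_between K.2.1 K.2.2|%:R / (#|K.1.1|%:R * #|K.1.2|%:R))
    (A := S) _ _)).
  by move=> _ [H1 [H2 [G1 [G2 [_ _ _ _ ->]]]]]; exists ((H1, H2), (G1, G2)).
exists [set a], (VH :\ a), [set a], [set~ a]; split=> //; split=> //.
- by apply/finset.set0Pn; exists a; rewrite inE.
- by apply/finset.set0Pn; exists b; rewrite !inE eq_sym ab.
- by apply/fintype.subsetP => v; rewrite !inE => /andP[].
Qed.

(** The difference of two basis vectors works, since by connectedness the kernel contains only
    constants. Existence keeps [phi0] from being a default value. *)
Lemma orth1_exists (Gconn : connected_graph G) (cardH : (2 <= #|VH|)%N) :
  exists2 x : 'cV[R]_#|VH|, x != 0 &
    orth1 x (fun y => persistent_coboundary R o H *m y = 0).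
Proof.
pose i := Ordinal (ltnW cardH); pose j := Ordinal cardH.
have ij : (i == j) = false by []; have ji : (j == i) = false by [].
exists (\col_k ((k == i)%:R - (k == j)%:R)).
  apply/eqP => /colP/(_ i); rewrite !mxE eqxx ij subr0.
  by move/eqP; rewrite oner_eq0.
move=> y /(coboundary_eq0 Gconn)[c ->].
have normE (z : 'cV[R]_#|VH|) : norm1 z =
    `|z i 0| + (`|z j 0| + \sum_(k | (k != i) && (k != j)) `|z k 0|).
  by rewrite /norm1 (bigD1 i) //= (bigD1 j) //= ji.
rewrite !normE.
rewrite [X in _ + (_ + X) <= _]big1 => [|k /andP[ki kj]]; last first.
  by rewrite mxE (negbTE ki) (negbTE kj) subrr normr0.
rewrite !mxE !eqxx ij ji subr0 sub0r addr0 normrN normr1 addrA.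
rewrite -[1 + 1]addr0 lerD ?sumr_ge0 //.
(* Triangle inequality: the two shifted entries already have total absolute value at least 2, the
   norm of the unshifted vector. *)
have -> : 1 + 1 = (1 + c) - (-1 + c) :> R by ring.
by apply: le_trans (ler_norm _) (ler_normB _ _).
Qed.

Lemma phi0_attained (Gconn : connected_graph G) (cardH : (2 <= #|VH|)%N) :
  exists x : 'cV[R]_#|VH|,
    [/\ x != 0, orth1 x (fun y => persistent_coboundary R o H *m y = 0) &
        phi0 R o H = norm1 (persistent_coboundary R o H *m x) / norm1 x].
Proof.
have [x1 x1_neq0 x1Y] := orth1_exists Gconn cardH.
have YZ b (y : 'cV[R]_#|VH|) : persistent_coboundary R o H *m y = 0 ->
    persistent_coboundary R o H *m (b *: y) = 0.
  by rewrite -scalemxAr => ->; rewrite scaler0.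
have [x [x0 xY xmin]] :=
  norm1_ratio_min (persistent_coboundary R o H) YZ x1_neq0 x1Y.
rewrite /phi0; set S := (X in minimum X); change (S (minimum S)).
apply: (proj1 (minimum_lb (A := S)
  (m := norm1 (persistent_coboundary R o H *m x) / norm1 x) _ _)).
  by exists x.
by move=> _ [y [y0 yY ->]]; exact: xmin.
Qed.

End Coboundary.

Theorem mainTheorem4 (R : realType) (G : sgraph) (o : orientation G)
    (H : subgraph G) (Gconn : connected_graph G)
    (cardH : (2 <= #|sub_vertex H|)%N) :
  hKron R o H <= h0 R H /\ phiKron R o H <= phi0 R o H.
Proof.
split.
  have [H1 [H2 [G1 [G2 [HE GE [H1_neq0 H1G] [H2_neq0 H2G] ->]]]]] :=
    h0_attained R cardH.
  apply: le_trans (hKron_le R o HE H1_neq0 H2_neq0) _.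
  rewrite ler_wpM2r ?invr_ge0 ?mulr_ge0 ?ler0n // ler_wpM2l ?ler0n //.
  apply: le_trans (cut_le_edges_between R o GE).
  apply: le_trans (energy_le_cut R o H G1).
  (* The energy sees only the trace on V(H), and [G1] meets V(H) exactly in [H1] because [H2] lies
     in the disjoint set [G2]. *)
  rewrite -(energyI R o H G1) (_ : G1 :&: sub_vertex H = H1) //.
  case: HE GE => <- _ [_ dG]; rewrite finset.setIUr (finset.setIidPr H1G).
  rewrite (_ : G1 :&: H2 = finset.set0) ?finset.setU0 //; apply/eqP.
  by rewrite finset.setI_eq0; apply: disjointWr H2G dG.
have [x [x0 xY ->]] := phi0_attained R o Gconn cardH.
have [f [fx ->]] := coboundary_grad o x.
rewrite ler_pdivlMr; last by rewrite lt0r norm1_eq0 x0 norm1_ge0.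
(* Here C is [phiKron], and the trace of [A] on V(H) is a competitor in its definition. *)
rewrite -fx in xY *; apply: cheeger_grad xY => A A0 A2.
rewrite -energyI; apply: phiKron_le => //; first by rewrite -card_gt0.
exact: finset.subsetIr.
Qed.
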